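(* Let $U_0, U_1\in M_n(\mathbb{C})$ be commuting unitary matrices, and let $W$ be an $n\times n$ unitary matrix such that $WU_1W^* = \mathrm{diag}(a_{11},\dots,a_{nn})$ and $WU_0W^* = \mathrm{diag}(b_{11},\dots,b_{nn})$. For each $1\le i\le n$ let $\lambda_i$ and $\mu_i$ be the two (distinct) roots in $\mathbb{C}$ of the polynomial $\lambda^2 + a_{ii}\lambda + b_{ii}$. Put $X_1 = \mathrm{diag}(\lambda_1,\dots,\lambda_n)$, $X_2 = \mathrm{diag}(\mu_1,\dots,\mu_n)$, and let $V$ be the (invertible) $2n\times 2n$ block Vandermonde matrix $$V = \begin{bmatrix} I & I \\ X_1 & X_2\end{bmatrix}.$$ Then $\kappa(V) < 2$.
   Context: $I$ is the $n\times n$ identity matrix. For a nonsingular matrix $X$, $\kappa(X) = \|X\|_2\|X^{-1}\|_2$ is the spectral condition number, where $\|\cdot\|_2$ is the spectral norm; equivalently, $\kappa(X)$ is the ratio of the largest to the smallest singular value of $X$. Under the stated hypotheses each polynomial $\lambda^2+a_{ii}\lambda+b_{ii}$ has two distinct roots and $V$ is invertible. *)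

(* Defs.v *)
From mathcomp Require Import all_boot all_order all_algebra.
From mathcomp Require Import complex.
From mathcomp Require Import boolp classical_sets reals.

Set Implicit Arguments.
Unset Strict Implicit.
Unset Printing Implicit Defensive.

Import Order.TTheory GRing.Theory Num.Theory.

Local Open Scope ring_scope.
Local Open Scope complex_scope.

Definition l2norm (R : realType) n (x : 'cV[R[i]]_n) : R :=
  Num.sqrt (\sum_(i < n) ComplexField.Normc.normc (x i 0) ^+ 2).

(* The set below is nonempty (it contains 0) and bounded, so [sup] is a genuine
   supremum. The closed unit ball, rather than the unit sphere, keeps the set
   nonempty when n = 0. *)
Definition spectral_norm (R : realType) m n (A : 'M[R[i]]_(m, n)) : R :=
  sup [set l2norm (A *m x) | x in [set x : 'cV[R[i]]_n | l2norm x <= 1]]%classic.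

(* Meaningful only for X \in unitmx, since invmx X = X otherwise. *)
Definition cond_number (R : realType) n (X : 'M[R[i]]_n) : R :=
  spectral_norm X * spectral_norm (invmx X).

Definition block_vandermonde (R : realType) n (X1 X2 : 'M[R[i]]_n) :
    'M[R[i]]_(n + n) :=
  block_mx 1%:M 1%:M X1 X2.

(* Main.v *)
Require Import Defs.
From mathcomp Require Import all_boot all_order all_algebra.
From mathcomp Require Import complex.
From mathcomp Require Import boolp classical_sets reals.
From mathcomp Require Import ring lra.

(**
  V is, up to a permutation of coordinates, the direct sum of the 2 x 2
  matrices V_i = [1, 1; lam_i, mu_i], where lam_i + mu_i = - a_ii and
  lam_i * mu_i = b_ii have modulus 1.  With s = |lam_i|^2 + |mu_i|^2, the matrix
  V_i^* V_i has trace 2 + s and determinant |lam_i - mu_i|^2 = 2 s - 1, and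
  2 <= s <= 3; hence its eigenvalues lie between 1 and (5 + sqrt 5) / 2 < 15 / 4.
  So ||V||^2 <= 15 / 4 and ||V^-1|| <= 1.
*)

Set Implicit Arguments.
Unset Strict Implicit.
Unset Printing Implicit Defensive.

Import Order.TTheory GRing.Theory Num.Theory.

Local Open Scope ring_scope.
Local Open Scope complex_scope.
Local Open Scope sesquilinear_scope.

Import ComplexField.Normc.

Lemma sqr_normcE (R : rcfType) (z : R[i]) :
  normc z ^+ 2 = complex.Re z ^+ 2 + complex.Im z ^+ 2.
Proof. by case: z => x y /=; rewrite sqr_sqrtr // addr_ge0 ?sqr_ge0. Qed.

(* The form is al |p|^2 + de |q|^2 + 2 Re ((u + i v) conj(p) q), for
   p = p1 + i p2 and q = q1 + i q2. *)
Lemma hermitian_form2_ge0 (R : realFieldType) (al de u v p1 p2 q1 q2 : R) :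
  0 < al + de -> u ^+ 2 + v ^+ 2 <= al * de ->
  0 <= al * (p1 ^+ 2 + p2 ^+ 2) + de * (q1 ^+ 2 + q2 ^+ 2)
       + 2 * (u * (p1 * q1 + p2 * q2) - v * (p1 * q2 - p2 * q1)).
Proof.
move=> tr_gt0 det_ge0.
set Q := (X in 0 <= X).
(* Completing the square in p, resp. in q, and adding. *)
have E : (al + de) * Q =
  (al * p1 + u * q1 - v * q2) ^+ 2 + (al * p2 + u * q2 + v * q1) ^+ 2
  + (de * q1 + u * p1 + v * p2) ^+ 2 + (de * q2 + u * p2 - v * p1) ^+ 2
  + (al * de - (u ^+ 2 + v ^+ 2)) * (p1 ^+ 2 + p2 ^+ 2 + q1 ^+ 2 + q2 ^+ 2).
  by rewrite /Q; ring.
rewrite -(pmulr_rge0 _ tr_gt0) E.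
by rewrite !addr_ge0 ?sqr_ge0 // mulr_ge0 ?subr_ge0 // !addr_ge0 ?sqr_ge0.
Qed.

(** With [G = V_i^* V_i], the two inequalities say that the Hermitian forms of [G - I] and
    [15/4 I - G] are nonnegative at [(p, q)]. *)
Lemma vandermonde2_bounds (R : rcfType) (l m p q : R[i]) :
  normc (l + m) = 1 -> normc (l * m) = 1 ->
  normc p ^+ 2 + normc q ^+ 2
    <= normc (p + q) ^+ 2 + normc (l * p + m * q) ^+ 2
    <= 15 / 4 * (normc p ^+ 2 + normc q ^+ 2).
Proof.
move=> /(congr1 (fun x => x ^+ 2)) + /(congr1 (fun x => x ^+ 2)).
rewrite !sqr_normcE.
case: l m p q => [l1 l2] [m1 m2] [p1 p2] [q1 q2] /=; rewrite expr1n => hs hp.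
(* Here [A = |l|^2], [B = |m|^2] and [x + i y = conj(l) m], so the off-diagonal entry of [G] is
   [1 + x + i y]. *)
pose A := l1 ^+ 2 + l2 ^+ 2; pose B := m1 ^+ 2 + m2 ^+ 2.
pose x := l1 * m1 + l2 * m2; pose y := l1 * m2 - l2 * m1.
have A0 : 0 <= A by rewrite addr_ge0 ?sqr_ge0.
have B0 : 0 <= B by rewrite addr_ge0 ?sqr_ge0.
have AB : A * B = 1 by rewrite -[RHS]hp /A /B; ring.
have xy : x ^+ 2 + y ^+ 2 = 1 by rewrite -[RHS]hp /x /y; ring.
have sx : A + B + 2 * x = 1 by rewrite -[RHS]hs /A /B /x; ring.
(* AM-GM with [A * B = 1]; the next bound, [-1 <= x], yields [A + B = 1 - 2 x <= 3]. *)
have s_ge2 : 2 <= A + B by have := sqr_ge0 (A - B); nra.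
have x_ge : -1 <= x by have := sqr_ge0 y; nra.
have det : (1 + x) ^+ 2 + y ^+ 2 = 3 - (A + B) by nra.
(* The determinants of the two forms are [A + B - 2] and [89/16 - 7/4 (A + B)], both nonnegative for
   [2 <= A + B <= 3]. *)
apply/andP; split; rewrite -subr_ge0.
- have := @hermitian_form2_ge0 _ A B (1 + x) y p1 p2 q1 q2.
  rewrite det AB => /(_ ltac:(lra) ltac:(lra)); congr (0 <= _).
  by rewrite /A /B /x /y; ring.
- have := @hermitian_form2_ge0 _ (11 / 4 - A) (11 / 4 - B) (- (1 + x)) (- y)
    p1 p2 q1 q2.
  have -> : (11 / 4 - A) * (11 / 4 - B) = 121 / 16 - 11 / 4 * (A + B) + A * B by field.
  rewrite AB !sqrrN det => /(_ ltac:(lra) ltac:(lra)); congr (0 <= _).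
  by rewrite /A /B /x /y; field.
Qed.

Lemma l2norm_ge0 (R : realType) n (x : 'cV[R[i]]_n) : 0 <= l2norm x.
Proof. exact: sqrtr_ge0. Qed.

Lemma sqr_l2norm (R : realType) n (x : 'cV[R[i]]_n) :
  l2norm x ^+ 2 = \sum_(i < n) normc (x i 0) ^+ 2.
Proof. by rewrite sqr_sqrtr // sumr_ge0 // => i _; exact: sqr_ge0. Qed.

Lemma l2norm0 (R : realType) n : l2norm (0 : 'cV[R[i]]_n) = 0.
Proof.
by rewrite /l2norm big1 ?sqrtr0 // => i _; rewrite mxE normc0 expr0n.
Qed.

Lemma l2norm_le0 (R : realType) n (x : 'cV[R[i]]_n) : l2norm x <= 0 -> x = 0.
Proof.
move=> x_le0; have x0 : l2norm x = 0 by apply: le_anti; rewrite x_le0 l2norm_ge0.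
have /esym/eqP := sqr_l2norm x; rewrite x0 expr0n psumr_eq0; last first.
  by move=> i _; exact: sqr_ge0.
move=> /allP xi0; apply/matrixP => i j; rewrite ord1 mxE.
by apply: eq0_normc; apply/eqP; rewrite -sqrf_eq0; exact: xi0 (mem_index_enum i).
Qed.

Lemma spectral_norm_bounds (R : realType) m n (A : 'M[R[i]]_(m, n)) (c : R) :
  0 <= c -> (forall x, l2norm (A *m x) <= c * l2norm x) ->
  0 <= spectral_norm A <= c.
Proof.
move=> c_ge0 Ac; rewrite /spectral_norm; set S := (X in sup X).
(* This makes [S] nonempty and also bounds its supremum below by 0. *)
have S0 : S 0 by exists 0; rewrite /= ?mulmx0 l2norm0 // ler01.
have Sc : ubound S c.
  by move=> _ [x /= x_le1 <-]; apply: le_trans (Ac x) _; rewrite ler_piMr.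
rewrite ge_sup ?andbT //; last by exists 0.
by apply: ub_le_sup S0; exists c.
Qed.

Section BlockVandermonde.
Variables (R : realType) (n : nat) (lam mu : 'rV[R[i]]_n).
Hypothesis sum1 : forall i, normc (lam 0 i + mu 0 i) = 1.
Hypothesis prod1 : forall i, normc (lam 0 i * mu 0 i) = 1.

Let V := block_vandermonde (diag_mx lam) (diag_mx mu).

Lemma sqr_l2norm_block_vandermonde (x : 'cV[R[i]]_(n + n)) :
  l2norm x ^+ 2 <= l2norm (V *m x) ^+ 2 <= 15 / 4 * l2norm x ^+ 2.
Proof.
rewrite -(vsubmxK x); set p := usubmx x; set q := dsubmx x.
rewrite /V /block_vandermonde mul_block_col !mul1mx !sqr_l2norm.
(* Coordinates [i] and [n + i] are paired, so that the bounds hold term by term. *)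
rewrite !big_split_ord /= -!big_split /= mulr_sumr.
have E i := vandermonde2_bounds (p i 0) (q i 0) (sum1 i) (prod1 i).
apply/andP; split; apply: ler_sum => i _; move/andP: (E i);
  by rewrite !col_mxEu !col_mxEd !mul_diag_mx !mxE => -[].
Qed.

Lemma l2norm_block_vandermonde_ge x : l2norm x <= l2norm (V *m x).
Proof.
have /andP[+ _] := sqr_l2norm_block_vandermonde x.
by rewrite ler_sqr ?nnegrE ?l2norm_ge0.
Qed.

Lemma l2norm_block_vandermonde_le x :
  l2norm (V *m x) <= Num.sqrt (15 / 4) * l2norm x.
Proof.
rewrite -ler_sqr ?nnegrE ?mulr_ge0 ?sqrtr_ge0 ?l2norm_ge0 //.
rewrite [leRHS]exprMn (@sqr_sqrtr _ (15 / 4)); last by lra.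
by have /andP[] := sqr_l2norm_block_vandermonde x.
Qed.

(** The lower bound makes [V] injective on columns; transposing turns this into row freeness of
    [V^T]. *)
Lemma block_vandermonde_unitmx : V \in unitmx.
Proof.
rewrite -unitmx_tr -row_free_unit; apply: inj_row_free => v vV0.
apply: trmx_inj; rewrite trmx0; apply: l2norm_le0.
apply: le_trans (l2norm_block_vandermonde_ge _) _.
by rewrite -(trmxK V) -trmx_mul vV0 trmx0 l2norm0.
Qed.

Lemma cond_number_block_vandermonde_lt2 : cond_number V < 2.
Proof.
have /andP[V0 Vle] :=
  spectral_norm_bounds (sqrtr_ge0 _) l2norm_block_vandermonde_le.
(* The lower bound for [V], taken at [invmx V *m x]. *)
have /andP[W0 Wle] : 0 <= spectral_norm (invmx V) <= 1.
  apply: spectral_norm_bounds => // x; rewrite mul1r.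
  by rewrite -{2}(mulKVmx block_vandermonde_unitmx x) l2norm_block_vandermonde_ge.
apply: le_lt_trans (ler_pM V0 W0 Vle Wle) _; rewrite mulr1.
(* Squaring reduces the claim to [15/4 < 4]. *)
by rewrite -(@ltr_pXn2r _ 2) ?nnegrE ?sqrtr_ge0 // sqr_sqrtr; lra.
Qed.

End BlockVandermonde.

Lemma normc_diag_unitary (R : rcfType) n (d : 'rV[R[i]]_n) i :
  diag_mx d \is unitarymx -> normc (d 0 i) = 1.
Proof.
move=> /unitarymxP/matrixP/(_ i i); rewrite mul_diag_mx !mxE eqxx !mulr1n => dd.
(* This norm is valued in [R[i]]; its real part is [normc]. *)
have : `|d 0 i| = 1.
  by apply/eqP; rewrite -(@eqrXn2 _ 2) ?normr_ge0 ?ler01 // expr1n normCK dd.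
by case.
Qed.

(** The hypothesis gives the root set without multiplicities. Since [- a - l] is a root, it is [m],
    or else [l]; then [l] is a double root and [m = l]. *)
Lemma vieta2 (F : fieldType) (a b l m : F) :
  (forall z, root ('X^2 + a *: 'X + b%:P) z = (z == l) || (z == m)) ->
  l + m = - a /\ l * m = b.
Proof.
move=> h.
have rE z : root ('X^2 + a *: 'X + b%:P) z = (z ^+ 2 + a * z + b == 0).
  by rewrite /root !hornerE.
have /eqP hl : l ^+ 2 + a * l + b == 0 by rewrite -rE h eqxx.
have /eqP hm : m ^+ 2 + a * m + b == 0 by rewrite -rE h eqxx orbT.
have h2 : (- a - l) ^+ 2 + a * (- a - l) + b == 0.
  by rewrite -hl; apply/eqP; ring.
have lm : l + m = - a.
  move: h2; rewrite -rE h => /orP[] /eqP e; last by rewrite -e; ring.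
  have aE : a = - (l + l) by rewrite -{2}e; ring.
  suff : (m - l) ^+ 2 == 0.
    by rewrite sqrf_eq0 subr_eq0 => /eqP ->; rewrite aE opprK.
  have : (m - l) ^+ 2 = (m ^+ 2 + a * m + b) - (l ^+ 2 + a * l + b).
    by rewrite aE; ring.
  by rewrite hm hl subrr => ->.
split=> //; apply/eqP; rewrite -subr_eq0; apply/eqP.
have aE : a = - (l + m) by rewrite lm opprK.
by rewrite -[RHS]oppr0 -hl aE; ring.
Qed.

Theorem theorem2p15 (R : realType) (n : nat) (U0 U1 W : 'M[R[i]]_n)
    (a b lam mu : 'rV[R[i]]_n)
    (hU0 : U0 \is unitarymx) (hU1 : U1 \is unitarymx)
    (hcomm : comm_mx U0 U1)
    (hW : W \is unitarymx)
    (ha : W *m U1 *m W^t* = diag_mx a)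
    (hb : W *m U0 *m W^t* = diag_mx b)
    (hroots : forall (i : 'I_n) (z : R[i]),
       root ('X^2 + a 0 i *: 'X + (b 0 i)%:P) z
         = (z == lam 0 i) || (z == mu 0 i)) :
  [/\ forall i : 'I_n, lam 0 i != mu 0 i,
      block_vandermonde (diag_mx lam) (diag_mx mu) \in unitmx &
      cond_number (block_vandermonde (diag_mx lam) (diag_mx mu)) < 2].
Proof.
have hW' : W^t* \is unitarymx by rewrite trmxC_unitary.
have sum1 i : normc (lam 0 i + mu 0 i) = 1.
  have [-> _] := vieta2 (hroots i).
  rewrite (normcN (a 0 i)); apply: normc_diag_unitary.
  rewrite -ha.
  exact: mul_unitarymx (mul_unitarymx hW hU1) hW'.
have prod1 i : normc (lam 0 i * mu 0 i) = 1.
  have [_ ->] := vieta2 (hroots i); apply: normc_diag_unitary.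
  rewrite -hb.
  exact: mul_unitarymx (mul_unitarymx hW hU0) hW'.
split.
(* A common value would have modulus both [1/2] (from the sum) and 1 (from the product). *)
- move=> i; apply/eqP => e; have := sum1 i; have := prod1 i.
  rewrite e -mulr2n normcMn normcM mulr2n; nra.
- exact: block_vandermonde_unitmx.
- exact: cond_number_block_vandermonde_lt2.
Qed.
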